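(* Let $U$ be a $k$-dimensional polynomial subspace with $n=\deg U$ and let $\ell=n+1-k$ be the codimension. Suppose $1\notin U$. Let $Q=W(U^{(\ell-1)})$. Then $U$ admits a basis of top powers if and only if the following two conditions hold: (i) $Q$ has $k$ simple roots, and (ii) every $q\in U^*$ is divisible by $Q$.
   Context: Work over $\mathbb C$. $\mathcal P_n$ is the vector space of polynomials in $z$ of degree $\le n$. A polynomial subspace is a finite-dimensional subspace of $\mathbb C[z]$ (here $k\ge1$); $\deg U=\max\{\deg p:p\in U\}$, so $U\subset\mathcal P_n$. $U^{(j)}$ denotes the span of the $j$th derivatives of the elements of $U$. For a finite-dimensional polynomial subspace $V$ with basis $p_1,\dots,p_r$, $W(V)$ is the Wronskian $\det(p_i^{(j-1)})_{1\le i,j\le r}$, a nonzero polynomial defined up to a nonzero scalar multiple. A top power is a polynomial of the form $(az+b)^n$ with $(a,b)\ne(0,0)$. Let $\gamma$ be the bilinear form on $\mathcal P_n$ with $n!\,\gamma\!\left(\frac{z^i}{i!},\frac{z^j}{j!}\right)=(-1)^i$ if $i+j=n$, and $0$ otherwise; the apolar dual of $U$ is $U^*=\{u\in\mathcal P_n:\gamma(u,v)=0\text{ for all }v\in U\}$. (Since $1\notin U$, one has $U\neq\mathcal P_n$, so $\ell\ge1$.) Roots in condition (i) are roots in $\mathbb C$. *)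

(* Defs.v *)
From HB Require Import structures.
From mathcomp Require Import all_boot all_order all_algebra.
From mathcomp Require Import ring.
From mathcomp Require Export complex.
From mathcomp Require Export reals.

Set Implicit Arguments.
Unset Strict Implicit.
Unset Printing Implicit Defensive.

Import GRing.Theory Num.Theory.
Local Open Scope ring_scope.

Section Subspaces.
Variables (F : numFieldType) (m : nat).
Implicit Types (U V : {vspace {poly_m F}}) (p q : {poly_m F}).

(* d = max {deg p : p in U}; [size p] is the degree plus one. *)
Definition subspace_degree U (d : nat) : Prop :=
  (exists2 p, p \in U & size p = d.+1) /\
  (forall p, p \in U -> (size p <= d.+1)%N).

(* [npolyp m] truncates to size <= m, which changes nothing here: see
   [nderivE]. *)
Definition nderiv (j : nat) p : {poly_m F} := npolyp m (p^`(j)).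

Lemma size_derivn_le (j : nat) (p : {poly F}) : (size p^`(j) <= size p)%N.
Proof.
elim: j => [|j IHj]; first by rewrite derivn0.
rewrite derivnS; apply: leq_trans IHj.
have [->|nz] := eqVneq p^`(j) 0; first by rewrite deriv0.
by rewrite ltnW ?lt_size_deriv.
Qed.

Lemma nderivE j p : nderiv j p = p^`(j) :> {poly F}.
Proof. by rewrite npolypK // (leq_trans (size_derivn_le _ _)) ?size_npoly. Qed.

Fact nderiv_is_linear j : linear (nderiv j).
Proof.
move=> a p q; apply/val_inj => /=.
by rewrite !nderivE /= derivnD derivnZ.
Qed.

HB.instance Definition _ j :=
  GRing.isLinear.Build F {poly_m F} {poly_m F} _ (nderiv j)
    (nderiv_is_linear j).

(* The set of j-th derivatives of elements of U is already a subspace. *)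
Definition derived_subspace (j : nat) U : {vspace {poly_m F}} :=
  (linfun (nderiv j) @: U)%VS.

Lemma derived_subspaceP j U q :
  reflect (exists2 p, p \in U & (q : {poly F}) = p^`(j))
          (q \in derived_subspace j U).
Proof.
apply: (iffP memv_imgP) => [[p pU ->]|[p pU qE]]; exists p => //.
  by rewrite lfunE /= nderivE.
by rewrite lfunE; apply/val_inj; rewrite /= qE nderivE.
Qed.

Definition wronskian (r : nat) (b : r.-tuple {poly_m F}) : {poly F} :=
  \det (\matrix_(i < r, j < r) (tnth b i : {poly F})^`(j)).

(* W(V) is only defined up to a nonzero scalar, so it is a relation. *)
Definition is_wronskian V (Q : {poly F}) : Prop :=
  exists2 b : (\dim V).-tuple {poly_m F}, basis_of V b & Q = wronskian b.

End Subspaces.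

Section TopPowers.
Variables (F : numFieldType) (n : nat).
Implicit Types (U : {vspace {poly_n.+1 F}}) (p q : {poly_n.+1 F}).

Definition top_power (p : {poly F}) : Prop :=
  exists a b : F, (a, b) != (0, 0) /\ p = (a *: 'X + b%:P) ^+ n.

Definition has_top_power_basis U : Prop :=
  exists2 b : seq {poly_n.+1 F}, basis_of U b
    & forall p, p \in b -> top_power p.

(* The bilinear form gamma on P_n; [apolar_formE] is its characterisation on
   the basis z^i / i!. *)
Definition apolar_form p q : F :=
  \sum_(i < n.+1) (-1) ^+ i / 'C(n, i)%:R * p`_i * q`_(n - i).

Lemma apolar_form_linearl (a : F) p p' q :
  apolar_form (a *: p + p') q = a * apolar_form p q + apolar_form p' q.
Proof.
rewrite /apolar_form mulr_sumr -big_split /=; apply: eq_bigr => i _.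
by rewrite coefD coefZ mulrDr mulrDl !mulrA (mulrC _ a) !mulrA.
Qed.

Lemma apolar_form_linearr (a : F) p q q' :
  apolar_form p (a *: q + q') = a * apolar_form p q + apolar_form p q'.
Proof.
rewrite /apolar_form mulr_sumr -big_split /=; apply: eq_bigr => i _.
by rewrite coefD coefZ mulrDr mulrCA.
Qed.

Lemma apolar_formE (i j : nat) : (i <= n)%N -> (j <= n)%N ->
  n`!%:R * apolar_form (npolyp n.+1 (i`!%:R^-1 *: 'X^i))
                       (npolyp n.+1 (j`!%:R^-1 *: 'X^j))
  = if (i + j == n)%N then (-1) ^+ i else 0.
Proof.
move=> le_in le_jn; have lt_in : (i < n.+1)%N by [].
rewrite /apolar_form (bigD1 (Ordinal lt_in)) //= big1 => [|t neq_ti]; last first.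
  rewrite coef_npolyp ltn_ord coefZ coefXn -val_eqE /= in neq_ti *.
  by rewrite (negPf neq_ti) !mulr0 mul0r.
rewrite addr0 !coef_npolyp lt_in ltnS leq_subr !coefZ !coefXn eqxx mulr1.
have -> : (n - i == j)%N = (i + j == n)%N.
  by rewrite -(eqn_add2l i) subnKC // eq_sym.
case: eqP => [<-|_]; last by rewrite !mulr0.
have nz t : t`!%:R != 0 :> F by rewrite pnatr_eq0 -lt0n fact_gt0.
have nzC : 'C(i + j, i)%:R != 0 :> F.
  by rewrite pnatr_eq0 -lt0n bin_gt0 leq_addr.
have /(congr1 (fun t => t%:R : F)) := bin_fact (leq_addr j i).
rewrite addKn !natrM => <-; rewrite mulr1.
move: nzC (nz i) (nz j); move: ('C(_, _)%:R) (i`!%:R) (j`!%:R) ((-1) ^+ i).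
by move=> c x y e nzc nzx nzy; field; rewrite nzc nzx nzy.
Qed.

Definition apolar_dual U (u : {poly_n.+1 F}) : Prop :=
  forall v, v \in U -> apolar_form u v = 0.

End TopPowers.

Definition simple_root (F : fieldType) (p : {poly F}) (x : F) : bool :=
  mup x p == 1%N.

(* The set of simple roots of p has exactly k elements. *)
Definition has_n_simple_roots (F : fieldType) (k : nat) (p : {poly F}) : Prop :=
  exists s : seq F,
    [/\ uniq s, size s = k & forall x, (x \in s) = simple_root p x].

(* Main.v *)
Require Import Defs.
From mathcomp Require Import all_boot all_order all_algebra.
From mathcomp Require Import complex reals.
From HB Require Import structures.
From mathcomp Require Import perm qpoly ring.

(** Since the constants are not in U, a basis of top powers can be rescaled to
    a basis of shifted powers (X - x)^n, and the question is which points x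
    occur. Two facts about these powers decide it.

    First, the apolar form against (X - x)^n is evaluation at x
    ([apolar_form_shifted_power]). Hence, the form being nondegenerate,
    (X - x)^n lies in U as soon as every element of U^* vanishes at x
    ([apolar_bidual]); and if U is spanned by the (X - x)^n for x in s, then
    U^* consists of the polynomials vanishing on s.

    Secondly, for k <= n distinct points, the (n - k)-th derivatives of the
    powers (X - x)^n are multiples of (X - x)^k, and their Wronskian is a
    nonzero constant times the product of the X - x: one factor X - x comes out
    of each row, and a Vandermonde determinant in the X - x remains, which is
    constant because their differences are ([wronskian_shifted_powers]). In
    particular k shifted powers are linearly independent
    ([shifted_powers_free]).

    If U has a basis of shifted powers at s, the second fact makes Q
    proportional to the product of the X - x for x in s, so its roots are
    simple and are the points of s, and the first fact makes Q divide every
    element of U^*. Conversely, if Q has k simple roots and divides every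
    element of U^*, the first fact puts k shifted powers into U, and they form
    a basis by independence and dimension. *)

Set Implicit Arguments.
Unset Strict Implicit.
Unset Printing Implicit Defensive.

Import GRing.Theory Num.Theory.
Local Open Scope ring_scope.

(** * Spans and linear images *)

Section LinearAlgebra.
Variables (K : fieldType) (aT rT : vectType K).

Lemma free_of_map (f : 'Hom(aT, rT)) (X : seq aT) :
  free (map f X) -> free X.
Proof.
rewrite /free size_map -limg_span => /eqP dimfX.
rewrite eqn_leq dim_span -{1}dimfX.
by rewrite -(limg_ker_dim f <<X>>%VS) leq_addl.
Qed.

(** This replaces each vector of a family by a normalized one on the same line: a
    top power spans the line of some shifted power. *)
Lemma span_sub_of_lines (I : eqType) (f : I -> aT) (b : seq aT) :
    (forall v, v \in b -> exists i, v \in <[f i]>%VS) ->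
  exists2 s : seq I, size s = size b & (<<b>> <= <<map f s>>)%VS.
Proof.
elim: b => [|v b IHb] b_f; first by exists [::].
have [i vi] := b_f v (mem_head v b).
have [w wb|s sz_s sub_s] := IHb; first by apply: b_f; rewrite inE wb orbT.
exists (i :: s); first by rewrite /= sz_s.
by rewrite !span_cons addvS.
Qed.

(** A repeated index would leave fewer than dim U spanning vectors, so
    distinctness of the indices comes from counting dimensions. *)
Lemma uniq_of_span_map (I : eqType) (f : I -> aT) (U : {vspace aT})
    (s : seq I) :
    (U <= <<map f s>>)%VS -> (size s <= \dim U)%N ->
  uniq s /\ <<map f s>>%VS = U.
Proof.
move=> Us le_s.
have leU (t : seq I) : (U <= <<map f t>>)%VS -> (\dim U <= size t)%N.
  by move/dimvS/leq_trans; apply; rewrite -(size_map f) dim_span.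
split; last first.
  apply/esym/eqP; rewrite eqEdim Us (leq_trans _ le_s) //.
  by rewrite -(size_map f) dim_span.
rewrite -[uniq s]negbK -ltn_size_undup -leqNgt (leq_trans le_s) // leU //.
by rewrite (eq_span (eq_mem_map f (mem_undup s))).
Qed.

End LinearAlgebra.

(** * Wronskians of finite families *)

Section Wronskians.
Variables (F : numFieldType) (m : nat).

Definition wronskian_mx r (b : r.-tuple {poly_m F}) : 'M[{poly F}]_r :=
  \matrix_(i < r, j < r) (tnth b i : {poly F})^`(j).

Lemma npoly_sumE r (c : 'I_r -> F) (b : 'I_r -> {poly_m F}) :
  (\sum_i c i *: b i : {poly_m F}) = \sum_i c i *: (b i : {poly F}) :> {poly F}.
Proof.
by elim/big_ind2: _ => // _ x _ y <- <-.
Qed.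

(** A constant relation between the polynomials is a relation between the rows
    of the Wronskian matrix; multiplying it by the adjugate turns it into the
    Wronskian times each coefficient. *)
Lemma wronskian_free r (b : r.-tuple {poly_m F}) : wronskian b != 0 -> free b.
Proof.
move=> Wn0; apply/freeP => c cb0 i.
pose v := \row_i (c i)%:P : 'rV[{poly F}]_r.
have vW0 : v *m wronskian_mx b = 0.
  apply/rowP => j; rewrite !mxE.
  have /(congr1 (fun p : {poly_m F} => (p : {poly F})^`(j))) := cb0.
  rewrite npoly_sumE /= raddf0 raddf_sum /= => cb0j; rewrite -[RHS]cb0j.
  by apply: eq_bigr => t _; rewrite !mxE derivnZ mul_polyC (tnth_nth 0).
have /rowP/(_ i) : v *m (wronskian_mx b *m \adj (wronskian_mx b)) = 0.
  by rewrite mulmxA vW0 mul0mx.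
rewrite mul_mx_adj mul_mx_scalar !mxE => /eqP.
by rewrite mulf_eq0 (negPf Wn0) /= polyC_eq0 => /eqP.
Qed.

(** The Wronskian matrix of b is a constant matrix times that of d, since
    differentiation is linear. *)
Lemma wronskian_span r (b d : r.-tuple {poly_m F}) :
  {subset b <= <<d>>%VS} -> exists c : F, wronskian b = c%:P * wronskian d.
Proof.
move=> bd.
pose A := \matrix_(i < r, j < r) coord d j (tnth b i).
exists (\det A); rewrite -det_map_mx -det_mulmx; congr (\det _).
apply/matrixP => i j; rewrite !mxE.
have bi : tnth b i \in <<d>>%VS by rewrite bd ?mem_tnth.
rewrite {1}(coord_span bi) npoly_sumE raddf_sum /=; apply: eq_bigr => t _.
by rewrite !mxE derivnZ mul_polyC (tnth_nth 0 d).
Qed.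

(** A nonzero Wronskian makes d a basis of V, so every basis of V has as many
    elements as d. Expressing d in another basis makes the Wronskian of d a
    constant multiple of the other one, and the constant cannot vanish. *)
Lemma is_wronskian_eqp r (d : r.-tuple {poly_m F}) (V : {vspace {poly_m F}})
    (Q : {poly F}) :
    <<d>>%VS = V -> wronskian d != 0 -> is_wronskian V Q -> Q %= wronskian d.
Proof.
move=> dV Wd [].
have dimV : r = \dim V.
  by have := wronskian_free Wd; rewrite /free dV size_tuple => /eqP.
case: _ / dimV => b bV ->{Q}.
have [x xb|c Wdb] := @wronskian_span _ d b.
  by rewrite (span_basis bV) -dV memv_span.
rewrite Wdb eqp_sym mul_polyC eqp_scale //.
by apply: contraNneq Wd => c0; rewrite Wdb c0 mul0r.
Qed.

End Wronskians.

(** * Powers of X - x *)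

Section ShiftedPowers.
Variables (F : numFieldType) (n : nat).

Definition shifted_power (x : F) : {poly_n.+1 F} :=
  npolyp n.+1 (('X - x%:P) ^+ n).

Lemma shifted_powerE x : shifted_power x = ('X - x%:P) ^+ n :> {poly F}.
Proof. by rewrite npolypK // size_exp_XsubC. Qed.

Lemma derivn_XsubC_exp (x : F) (m j : nat) :
  (('X - x%:P) ^+ m)^`(j) = ('X - x%:P) ^+ (m - j) *+ m ^_ j.
Proof.
elim: j => [|j IHj]; first by rewrite derivn0 subn0.
rewrite derivnS IHj derivMn.
by rewrite deriv_exp derivXsubC mul1r -mulrnA ffactnSr subnS mulnC.
Qed.

(** Up to order of columns and factors from the rows and columns, this is the
    Vandermonde determinant in the X - x. The bound k <= n makes the orders of
    derivation at most n, so that no falling factorial vanishes. *)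
Lemma wronskian_shifted_powers k (s : k.-tuple F) : (k <= n)%N -> uniq s ->
  wronskian (map_tuple (nderiv (n - k)) (map_tuple shifted_power s))
    %= \prod_(x <- s) ('X - x%:P).
Proof.
move=> le_kn uniq_s.
(* Row i, column j of the Wronskian matrix is (X - s_i)^(k - j) times the
   falling factorial c_j. The diagonal matrix a takes one factor X - s_i out,
   which leaves the Vandermonde exponents k - 1 - j in reverse order, whence
   the permutation t. *)
pose a : 'rV[{poly F}]_k := \row_i ('X - (tnth s i)%:P).
pose c : 'rV[{poly F}]_k := \row_(j < k) (n ^_ (n - k + j))%:R.
pose t := perm (@rev_ord_inj k).
have -> : wronskian (map_tuple (nderiv (n - k)) (map_tuple shifted_power s))
  = \det (diag_mx a *m (perm_mx t *m Vandermonde k a)^T *m diag_mx c).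
  congr (\det _); apply/matrixP => i j.
  rewrite mul_mx_diag mul_diag_mx -row_permE !mxE !tnth_map permE /=.
  rewrite nderivE shifted_powerE -[(_^`(_))^`(j)]iterD [(j + _)%N]addnC.
  rewrite -/(derivn _ _) derivn_XsubC_exp.
  have -> : (n - (n - k + j) = (k - j.+1).+1)%N.
    by rewrite subnDA subKn // -subnSK.
  by rewrite -exprS mulr_natr.
rewrite !det_mulmx det_tr det_mulmx det_perm det_Vandermonde !det_diag.
have -> : \prod_(x <- s) ('X - x%:P) = \prod_i a 0 i.
  by rewrite big_tuple; apply: eq_bigr => i _; rewrite mxE.
rewrite -mulrA mulrC.
(* the constant left once the product of the X - s_i is set aside *)
pose e : F := (-1) ^+ t *
    (\prod_(i < k) \prod_(j < k | (i < j)%N) (tnth s i - tnth s j)) *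
    \prod_(j < k) (n ^_ (n - k + j))%:R.
have e_n0 : e != 0.
  rewrite !mulf_neq0 ?signr_eq0 //.
    apply/prodf_neq0 => i _; apply/prodf_neq0 => j lt_ij.
    rewrite subr_eq0 (inj_eq (tuple_uniqP _ uniq_s)).
    by rewrite neq_ltn lt_ij.
  apply/prodf_neq0 => j _; rewrite pnatr_eq0 -lt0n ffact_gt0.
  by rewrite -[leqRHS](subnK le_kn) leq_add2l ltnW.
set C := (X in X * _).
have -> : C = e%:P.
  rewrite /C /e !polyCM; congr (_ * _ * _).
  - by rewrite rmorph_sign.
  - rewrite rmorph_prod; apply: eq_bigr => i _.
    rewrite rmorph_prod; apply: eq_bigr => j _.
    by rewrite !mxE opprB addrC addrA subrK /= polyCB.
  by rewrite rmorph_prod; apply: eq_bigr => j _; rewrite mxE rmorph_nat.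
by rewrite mul_polyC eqp_scale.
Qed.

Lemma shifted_powers_derived_free (s : seq F) : (size s <= n)%N -> uniq s ->
  free (map (nderiv (n - size s)) (map shifted_power s)).
Proof.
move=> le_sn uniq_s.
have W := @wronskian_shifted_powers _ (in_tuple s) le_sn uniq_s.
apply: (@wronskian_free F n.+1 _
  (map_tuple (nderiv (n - size s)) (map_tuple shifted_power (in_tuple s)))).
by rewrite -size_poly_gt0 (eqp_size W) size_prod_XsubC.
Qed.

Lemma shifted_powers_free (s : seq F) : (size s <= n)%N -> uniq s ->
  free (map shifted_power s).
Proof.
move=> le_sn uniq_s.
apply: (@free_of_map _ _ _ (linfun (nderiv (n - size s)))).
rewrite (eq_map (lfunE _)); exact: shifted_powers_derived_free.
Qed.

(** A top power (a X + b)^n with a = 0 is a nonzero constant (for n = 0 it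
    is 1), which U excludes; with a nonzero it is proportional to a shifted
    power at - b / a. *)
Lemma has_top_power_basisP (U : {vspace {poly_n.+1 F}}) :
    npolyp n.+1 1 \notin U ->
  has_top_power_basis U <->
  exists s : seq F, [/\ uniq s, size s = \dim U
                      & <<map shifted_power s>>%VS = U].
Proof.
move=> U1; split=> [[b bU b_top]|[s [uniq_s sz_s sU]]].
  have [p pb|s sz_s sub_s] := @span_sub_of_lines _ _ _ shifted_power b.
    have pU : p \in U := basis_mem bU pb.
    have [a [c [ac_n0 pE]]] := b_top p pb.
    have [a0|a_n0] := eqVneq a 0.
      case/negP: U1; move: pE ac_n0; rewrite a0 scale0r add0r -rmorphXn /=.
      move=> pE ac_n0.
      have cn : c ^+ n != 0.
        have [n0|n_gt0] := posnP n; first by rewrite n0 expr0 oner_neq0.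
        by move: ac_n0; rewrite xpair_eqE eqxx /= => c0; rewrite expf_neq0.
      suff -> : npolyp n.+1 1 = (c ^+ n)^-1 *: p by rewrite memvZ.
      apply/val_inj; rewrite /= pE npolypK ?size_poly1 //.
      by rewrite -mul_polyC -polyCM mulVf.
    exists (- (c / a)); apply/vlineP; exists (a ^+ n).
    apply/val_inj; rewrite /= shifted_powerE pE -exprZn.
    by rewrite polyCN opprK scalerDr -(mul_polyC a (_%:P)) -polyCM mulrC divfK.
  (* the points are distinct because there are only dim U of them *)
  have sz_b : size b = \dim U := esym (size_basis (X := in_tuple b) bU).
  exists s; rewrite sz_s.
  have [] := @uniq_of_span_map _ _ _ shifted_power U s => //.
    by rewrite -(span_basis bU).
  by rewrite sz_s sz_b.
exists (map shifted_power s).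
  by rewrite basisEdim sU subvv size_map sz_s leqnn.
move=> _ /mapP[x _ ->]; exists 1, (- x).
by rewrite shifted_powerE scale1r polyCN xpair_eqE oner_eq0.
Qed.

End ShiftedPowers.

(** * Simple roots and proportional polynomials *)

Section SimpleRoots.
Variable F : fieldType.
Implicit Types (p q : {poly F}) (x : F).

Lemma simple_root_root p x : simple_root p x -> root p x.
Proof. by rewrite /simple_root; apply: contraLR => /mupNroot ->. Qed.

(** Multiplicity one means divisibility by X - x but not by its square, and
    divisibility does not see nonzero scalars. *)
Lemma eqp_simple_root p q x : q != 0 -> p %= q ->
  simple_root p x = simple_root q x.
Proof.
move=> q0 pq; have p0 : p != 0.
  by rewrite -size_poly_gt0 (eqp_size pq) size_poly_gt0.
by rewrite /simple_root !eqn_leq !mup_leq // !mup_geq // !(eqp_dvdr _ pq).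
Qed.

End SimpleRoots.

(** * The apolar form *)

Section Apolarity.
Variables (F : numFieldType) (n : nat).
Implicit Types (U : {vspace {poly_n.+1 F}}) (p q : {poly_n.+1 F}).

(** The coefficient of X^(n - i) in (X - x)^n is the binomial coefficient
    times (- x)^i: the sign and the binomial coefficient are exactly those that
    the form divides out. *)
Lemma apolar_form_shifted_power q x :
  apolar_form q (shifted_power n x) = (q : {poly F}).[x].
Proof.
rewrite (horner_coef_wide _ (size_npoly q)); apply: eq_bigr => i _.
have le_in : (i <= n)%N by rewrite -ltnS.
have bin_n0 : 'C(n, i)%:R != 0 :> F by rewrite pnatr_eq0 -lt0n bin_gt0.
have -> : (shifted_power n x : {poly F})`_(n - i)
    = (-1) ^+ i * x ^+ i * 'C(n, i)%:R.
  rewrite shifted_powerE exprBn coef_sum (bigD1 i) //= big1 => [|j neq_ji].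
    rewrite addr0 coefMn -!rmorphXn /= -[-1]/(- 1%:P) -polyCN -rmorphXn /=.
    by rewrite coefMC coefCM coefXn eqxx mulr1 mulr_natr.
  rewrite coefMn -!rmorphXn /= -[-1]/(- 1%:P) -polyCN -rmorphXn /=.
  rewrite coefMC coefCM coefXn eqn_sub2lE // -1?ltnS //.
  by rewrite eq_sym [_ == _](negPf neq_ji) mulr0 mul0r mul0rn.
have sgn2 : (-1) ^+ i * (-1) ^+ i = 1 :> F by rewrite -expr2 sqrr_sign.
rewrite -[RHS]mul1r -[1 in RHS]sgn2.
by move: ((-1) ^+ i) => e; field.
Qed.

(** Nondegeneracy: the form pairs X^i only with X^(n - i), so the i-th
    coefficient of the representing polynomial is phi (X^(n - i)), up to the
    weight of that pair. *)
Lemma apolar_form_represents (phi : {scalar {poly_n.+1 F}}) :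
  exists u, forall v, apolar_form u v = phi v.
Proof.
pose X i : {poly_n.+1 F} := npolyp n.+1 'X^i.
exists (npolyp n.+1
  (\poly_(i < n.+1) ((-1) ^+ i * 'C(n, i)%:R * phi (X (n - i)%N)))) => v.
have {2}-> : v = \sum_(i < n.+1) v`_(n - i) *: X (n - i)%N.
  apply/val_inj/polyP => t /=.
  rewrite npoly_sumE coef_sum.
  have [lt_tn|le_nt] := ltnP t n.+1; last first.
    rewrite [LHS]nth_default ?(leq_trans (size_npoly v)) // big1 // => i _.
    rewrite coefZ coef_npolyp; case: ltnP => [_|_]; last by rewrite mulr0.
    rewrite coefXn; case: eqP => [tE|_]; last by rewrite mulr0.
    by move: le_nt; rewrite tE ltnNge leq_subr.
  rewrite (bigD1 (rev_ord (Ordinal lt_tn))) //= big1 => [|i].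
    by rewrite coefZ coef_npolyp subSS subKn // lt_tn coefXn eqxx mulr1 addr0.
  rewrite -(inj_eq rev_ord_inj) rev_ordK -val_eqE /= subSS => neq_it.
  by rewrite coefZ coef_npolyp lt_tn coefXn eq_sym (negPf neq_it) mulr0.
rewrite linear_sum; apply: eq_bigr => i _; rewrite linearZ /=.
rewrite coef_npolyp ltn_ord coef_poly ltn_ord.
have bin_n0 : 'C(n, i)%:R != 0 :> F by rewrite pnatr_eq0 -lt0n bin_gt0 -ltnS.
have sgn2 : (-1) ^+ i * (-1) ^+ i = 1 :> F by rewrite -expr2 sqrr_sign.
rewrite -[RHS]mul1r -[1 in RHS]sgn2.
by move: ((-1) ^+ i) => e; field.
Qed.

(** The projection along U onto a complement has U as its kernel, and each of
    its coefficients is a linear form vanishing on U, hence represented by an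
    element of the apolar dual. If p pairs to zero with all of these, its
    projection is zero. *)
Lemma apolar_bidual U p :
  (forall u, apolar_dual U u -> apolar_form u p = 0) -> p \in U.
Proof.
move=> Up.
suff /val_inj : (p - projv U p : {poly F}) = (0 : {poly_n.+1 F}).
  by move/subr0_eq => ->; apply: memv_proj.
apply/polyP => j; rewrite coef0.
pose phi (v : {poly_n.+1 F}) : F := (v - projv U v)`_j.
have phiP : scalar phi.
  move=> a v w; rewrite /phi linearP /= opprD addrACA -scalerBr.
  by rewrite coefD coefZ.
pose phiL : {scalar {poly_n.+1 F}} :=
  HB.pack phi (GRing.isLinear.Build F {poly_n.+1 F} F _ phi phiP).
have [u uE] := apolar_form_represents phiL.
rewrite -[LHS]/(phiL p) -uE; apply: Up => v vU.
by rewrite uE /= /phi projv_id // subrr coef0.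
Qed.

End Apolarity.

(** * The criterion *)

(** This is the criterion over any numeric field; n - k is l - 1, the order
    of derivation. *)
Lemma has_top_power_basis_wronskianP (F : numFieldType) (n k : nat)
    (U : {vspace {poly_n.+1 F}}) (Q : {poly F}) :
    (k <= n)%N -> \dim U = k -> npolyp n.+1 1 \notin U ->
    is_wronskian (derived_subspace (n - k) U) Q ->
  has_top_power_basis U <->
  has_n_simple_roots k Q /\
  (forall q : {poly_n.+1 F}, apolar_dual U q -> Q %| (q : {poly F})).
Proof.
move=> le_kn dimU U1 WQ.
apply: iff_trans (has_top_power_basisP U1) _; rewrite dimU; split.
  case=> s [uniq_s sz_s sU]; rewrite -sz_s in le_kn WQ *.
  have Ws := wronskian_shifted_powers (s := in_tuple s) le_kn uniq_s.
  have P_neq0 : \prod_(x <- s) ('X - x%:P) != 0.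
    by rewrite -size_poly_gt0 size_prod_XsubC.
  have QP : Q %= \prod_(x <- s) ('X - x%:P).
    apply: (eqp_trans _ Ws); apply: is_wronskian_eqp WQ.
      by rewrite /derived_subspace -sU limg_span (eq_map (lfunE _)).
    by rewrite -size_poly_gt0 (eqp_size Ws) size_poly_gt0.
  split=> [|q qU].
    exists s; split=> // x; rewrite (eqp_simple_root _ P_neq0 QP).
    by rewrite /simple_root mu_prod_XsubC count_uniq_mem // eqb1.
  rewrite (eqp_dvdl _ QP) uniq_roots_dvdp ?uniq_rootsE //.
  apply/allP => x xs; apply/rootP; rewrite -apolar_form_shifted_power.
  by apply: qU; rewrite -sU memv_span ?map_f.
case=> -[s [uniq_s sz_s sQ]] UQ; exists s; split=> //.
have sU : (<<map (shifted_power n) s>> <= U)%VS.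
  apply/span_subvP => _ /mapP[x xs ->]; apply: apolar_bidual => u /UQ Qu.
  rewrite apolar_form_shifted_power; apply/rootP; apply: root_dvdp Qu _.
  by apply: simple_root_root; rewrite -sQ.
apply/eqP; rewrite eqEdim sU dimU -sz_s; rewrite -sz_s in le_kn.
have := shifted_powers_free le_kn uniq_s.
by rewrite /free size_map => /eqP ->; rewrite leqnn.
Qed.

Theorem theorem5p17 (R : realType) (n k l : nat)
    (U : {vspace {poly_n.+1 R[i]}}) (Q : {poly R[i]})
    (k_gt0 : (0 < k)%N)
    (dimU : \dim U = k)
    (degU : subspace_degree U n)
    (l_def : l = (n + 1 - k)%N)
    (U_no_1 : npolyp n.+1 1 \notin U)
    (Q_def : is_wronskian (derived_subspace (l - 1) U) Q) :
  has_top_power_basis U <->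
  has_n_simple_roots k Q /\
  (forall q : {poly_n.+1 R[i]}, apolar_dual U q -> Q %| (q : {poly R[i]})).
Proof.
have le_kn : (k <= n)%N.
  suff : (\dim U < \dim (fullv : {vspace {poly_n.+1 R[i]}}))%N.
    by rewrite dim_polyn dimU.
  (* if k = n + 1 then U is the whole space, which contains 1 *)
  rewrite ltnNge; apply: contra U_no_1 => le_dim.
  have -> : U = fullv by apply/eqP; rewrite eqEdim subvf.
  exact: memvf.
apply: has_top_power_basis_wronskianP => //.
by rewrite l_def addn1 subSn // subn1 in Q_def.
Qed.
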